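(* Let $A\in\mathbb{R}^{n\times n}$ be symmetric positive definite and $b\in\mathbb{R}^n$, and consider the gradient method $x_{j+1}=x_j-\alpha_jg_j$ applied to $\min_{x\in\mathbb{R}^n}\frac12x^{\sf T}Ax-b^{\sf T}x$, where $g_j=Ax_j-b$. Let $k\ge3$, suppose that $I-\alpha_{k-2}A$ and $I-\alpha_{k-1}A$ are invertible, and that the following quadratic equation in $\alpha_k$ has a (real) solution: \begin{align*} &g_{k-2}^{\sf T}(I-\alpha_{k-2}A)^{-1}(I-\alpha_kA)g_{k}\cdot g_{k-1}^{\sf T}(I-\alpha_{k-1}A)^{-1}(I-\alpha_kA)g_{k}\\ &\quad=g_{k-2}^{\sf T}(I-\alpha_{k-2}A)^{-1}(I-\alpha_{k-1}A)^{-1}(I-\alpha_kA)g_{k}\cdot g_{k-1}^{\sf T}(I-\alpha_kA)g_{k}. \end{align*} Suppose that $\alpha_{k-1}^{BB1}\neq\alpha_{k}^{BB1}$. Then the stepsize $$\alpha_k^{new}=\frac{2}{\frac{\phi_2}{\phi_3}+\sqrt{\left(\frac{\phi_2}{\phi_3}\right)^2-4\,\frac{\phi_1}{\phi_3}}},$$ where $$\frac{\phi_1}{\phi_3}=\frac{\alpha_{k-1}^{BB2}-\alpha_{k}^{BB2}}{\alpha_{k-1}^{BB2}\alpha_{k}^{BB2}(\alpha_{k-1}^{BB1}-\alpha_{k}^{BB1})}\quad\text{and}\quad\frac{\phi_2}{\phi_3}=\frac{\alpha_{k-1}^{BB1}\alpha_{k-1}^{BB2}-\alpha_{k}^{BB1}\alpha_{k}^{BB2}}{\alpha_{k-1}^{BB2}\alpha_{k}^{BB2}(\alpha_{k-1}^{BB1}-\alpha_{k}^{BB1})},$$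 is a solution $\alpha_k$ of this equation.
   Context: The Barzilai-Borwein stepsizes are $$\alpha_j^{BB1}=\frac{s_{j-1}^{\sf T}s_{j-1}}{s_{j-1}^{\sf T}y_{j-1}},\qquad \alpha_j^{BB2}=\frac{s_{j-1}^{\sf T}y_{j-1}}{y_{j-1}^{\sf T}y_{j-1}},$$ where $s_{j-1}=x_j-x_{j-1}$ and $y_{j-1}=g_j-g_{j-1}$. The vectors $s_{k-1}$ and $s_{k-2}$ are nonzero, so that the BB stepsizes with indices $k-1$ and $k$ are defined. For a quadratic objective, the iteration gives $g_{j+1}=(I-\alpha_jA)g_j$. *)

(* Defs.v *)
From mathcomp Require Import all_boot all_order all_algebra.
From mathcomp Require Import reals.
Set Implicit Arguments.
Unset Strict Implicit.
Unset Printing Implicit Defensive.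
Import Order.TTheory GRing.Theory Num.Theory.
Local Open Scope ring_scope.

Definition dotv (R : realType) (n : nat) (u v : 'cV[R]_n) : R :=
  (u^T *m v) 0 0.

Definition sym_posdef (R : realType) (n : nat) (A : 'M[R]_n) : Prop :=
  A^T = A /\ forall v : 'cV[R]_n, v != 0 -> 0 < dotv v (A *m v).

(* Gradient of x |-> (1/2) x^T A x - b^T x, for symmetric A. *)
Definition grad (R : realType) (n : nat) (A : 'M[R]_n) (b x : 'cV[R]_n) :
  'cV[R]_n := A *m x - b.

Section Stepsizes.
Variables (R : realType) (n : nat) (A : 'M[R]_n) (b : 'cV[R]_n).
Variables (x : nat -> 'cV[R]_n) (alpha : nat -> R).

Definition g (j : nat) : 'cV[R]_n := grad A b (x j).

(* Forward differences; the stepsizes of index j use those of index j - 1. *)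
Definition s (j : nat) : 'cV[R]_n := x j.+1 - x j.
Definition y (j : nat) : 'cV[R]_n := g j.+1 - g j.

Definition BB1 (j : nat) : R := dotv (s j.-1) (s j.-1) / dotv (s j.-1) (y j.-1).
Definition BB2 (j : nat) : R := dotv (s j.-1) (y j.-1) / dotv (y j.-1) (y j.-1).

Definition step_mx (a : R) : 'M[R]_n := 1%:M - a *: A.

(* The unknown alpha_k is t; among the stepsizes of the method, only those of
   indices k - 2 and k - 1 occur. *)
Definition stepsize_eqn (k : nat) (t : R) : Prop :=
  let M2 := invmx (step_mx (alpha (k - 2))) in
  let M1 := invmx (step_mx (alpha (k - 1))) in
  dotv (g (k - 2)) (M2 *m step_mx t *m g k)
    * dotv (g (k - 1)) (M1 *m step_mx t *m g k)
  = dotv (g (k - 2)) (M2 *m M1 *m step_mx t *m g k)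
    * dotv (g (k - 1)) (step_mx t *m g k).

(* The ratios phi_1 / phi_3 and phi_2 / phi_3. *)
Definition phi13 (k : nat) : R :=
  (BB2 (k - 1) - BB2 k) / (BB2 (k - 1) * BB2 k * (BB1 (k - 1) - BB1 k)).
Definition phi23 (k : nat) : R :=
  (BB1 (k - 1) * BB2 (k - 1) - BB1 k * BB2 k)
    / (BB2 (k - 1) * BB2 k * (BB1 (k - 1) - BB1 k)).

Definition alpha_new (k : nat) : R :=
  2 / (phi23 k + Num.sqrt (phi23 k ^+ 2 - 4 * phi13 k)).

End Stepsizes.

(* Main.v *)
Require Import Defs.
From mathcomp Require Import all_boot all_order all_algebra.
From mathcomp Require Import reals.
From mathcomp Require Import ring lra.
Import Order.TTheory GRing.Theory Num.Theory.
Local Open Scope ring_scope.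

(** All the matrices in the equation are polynomials in the symmetric matrix
    [A], or inverses of such, so they commute and can be moved across the inner
    product.  Write [u], [v] for the gradients of indices [k - 2], [k - 1] and
    [beta] for the stepsize of index [k - 1].  Since the gradient of index [k]
    is [(I - beta A) v] and [v = (I - alpha_{k-2} A) u], the inverses cancel
    and the equation becomes
      [u'(I - tA)(I - beta A)u * v'(I - tA)v
         = u'(I - tA)u * v'(I - tA)(I - beta A)v],
    that is, [beta (Q_u P_v - P_u Q_v) = 0] with [P_w = w'w - t w'Aw] and
    [Q_w = w'Aw - t w'A^2w] ([step_equation_moments]).

    Because [s_{k-2}] and [s_{k-1}] are nonzero multiples of [u] and [v], we
    have [beta <> 0] and the BB stepsizes are the ratios of consecutive moments
    [w'w], [w'Aw], [w'A^2w] ([BB_moments]), so that dividing by the nonzero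
    number [BB1_{k-1} - BB1_k] turns the equation into
      [phi13 t^2 - phi23 t + 1 = 0] ([stepsize_eqn_quadratic]).
    In terms of [r = 1/t] this is the monic [r^2 - phi23 r + phi13 = 0], whose
    larger root is the reciprocal of the proposed stepsize.  A real solution
    makes the discriminant nonnegative, and the larger root cannot vanish: it
    would force [phi13 = 0], hence [BB2_{k-1} = BB2_k], and then
    [phi23 = 1 / BB2_k > 0]. *)

(** * Reciprocal roots of a quadratic *)

(** A solution [t] is nonzero and [(2 / t - q)^2] is the discriminant of the
    monic equation for [1 / t]; this is what makes the square root genuine.
    The larger root of that equation vanishes only if [p = 0] and [q <= 0],
    which is the case to be excluded before inverting it. *)
Lemma reciprocal_quadratic_root (R : rcfType) (p q : R) :
    (exists t : R, p * t ^+ 2 - q * t + 1 = 0) ->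
    (p = 0 -> 0 < q) ->
  let t0 := 2 / (q + Num.sqrt (q ^+ 2 - 4 * p)) in
  p * t0 ^+ 2 - q * t0 + 1 = 0.
Proof.
move=> [t ht] pq /=.
have t_neq0 : t != 0.
  by apply: contra_eqN ht => /eqP->; rewrite expr0n !mulr0 subr0 add0r oner_eq0.
have disc_ge0 : 0 <= q ^+ 2 - 4 * p.
  have -> : q ^+ 2 - 4 * p = (2 / t - q) ^+ 2.
    have -> : p = (q * t - 1) / t ^+ 2.
      by apply: (canRL (mulfK _)); [rewrite expf_neq0 | lra].
    by field.
  exact: sqr_ge0.
have := sqr_sqrtr disc_ge0; have := sqrtr_ge0 (q ^+ 2 - 4 * p).
set d := Num.sqrt _ => d_ge0 hd.
have root_neq0 : q + d != 0.
  apply/eqP => qd0; have dq : d = - q by lra.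
  suff /pq : p = 0 by lra.
  by move: hd; rewrite dq sqrrN; lra.
have -> : p = (q ^+ 2 - d ^+ 2) / 4 by lra.
by field.
Qed.

(** * The inner product and the step matrices *)

Section InnerProduct.
Variables (R : realType) (n : nat).
Implicit Types (u v w : 'cV[R]_n) (A : 'M[R]_n) (a c t : R).

Lemma dotvDr u v w : dotv u (v + w) = dotv u v + dotv u w.
Proof. by rewrite /dotv mulmxDr mxE. Qed.

Lemma dotvZr a u v : dotv u (a *: v) = a * dotv u v.
Proof. by rewrite /dotv -scalemxAr mxE. Qed.

Lemma dotvBr u v w : dotv u (v - w) = dotv u v - dotv u w.
Proof. by rewrite dotvDr -scaleN1r dotvZr mulN1r. Qed.

Lemma dotvC u v : dotv u v = dotv v u.
Proof. by rewrite /dotv -[in RHS](trmxK u) -trmx_mul [RHS]mxE. Qed.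

Lemma dotvZl a u v : dotv (a *: u) v = a * dotv u v.
Proof. by rewrite dotvC dotvZr dotvC. Qed.

Lemma dotv_mulmxl A u v : dotv (A *m u) v = dotv u (A^T *m v).
Proof. by rewrite /dotv trmx_mul mulmxA. Qed.

Lemma dotv_gt0 u : u != 0 -> 0 < dotv u u.
Proof.
move=> u_neq0; rewrite /dotv mxE.
have sq_ge0 i : 0 <= u^T 0 i * u i 0 by rewrite mxE -expr2 sqr_ge0.
rewrite lt_neqAle sumr_ge0 ?andbT // eq_sym.
apply: contra u_neq0; rewrite psumr_eq0 // => /allP u0.
apply/eqP/matrixP => i j; rewrite ord1 mxE.
by apply/eqP; have := u0 i (mem_index_enum i); rewrite mxE /= mulf_eq0 orbb.
Qed.

Lemma step_mxM p A t (w : 'M[R]_(n, p)) : step_mx A t *m w = w - t *: (A *m w).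
Proof. by rewrite /step_mx mulmxBl mul1mx scalemxAl. Qed.

Lemma step_mx_comm A a c : step_mx A a *m step_mx A c = step_mx A c *m step_mx A a.
Proof.
rewrite !step_mxM /step_mx !mulmxBr !mulmx1 -!scalemxAr !scalerBr !scalerA.
by rewrite [c * a]mulrC !opprB addrACA [in RHS]addrACA [- _ - _]addrC.
Qed.

(** The pattern in which every inverse matrix of the equation occurs, once the
    last gradient is expressed through an earlier one. *)
Lemma invmx_step_cancel A a t w : step_mx A a \in unitmx ->
  invmx (step_mx A a) *m step_mx A t *m (step_mx A a *m w) = step_mx A t *m w.
Proof.
by move=> Aa_unit; rewrite !mulmxA -(mulmxA (invmx _)) (step_mx_comm A t a) mulKmx.
Qed.

End InnerProduct.

(** * The stepsize equation in terms of moments *)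

Section Moments.
Variables (R : realType) (n : nat) (A : 'M[R]_n).
Hypothesis A_spd : sym_posdef A.
Implicit Types (u v w : 'cV[R]_n).

Lemma dotv_AA w : dotv (A *m w) (A *m w) = dotv w (A *m (A *m w)).
Proof. by rewrite dotv_mulmxl; case: A_spd => ->. Qed.

Lemma dotv_A_gt0 w : w != 0 -> 0 < dotv w (A *m w).
Proof. by case: A_spd => _; apply. Qed.

Lemma dotv_AA_gt0 w : w != 0 -> 0 < dotv w (A *m (A *m w)).
Proof.
move=> w_neq0; rewrite -dotv_AA; apply/dotv_gt0/eqP => Aw0.
by have := dotv_A_gt0 w w_neq0; rewrite Aw0 /dotv mulmx0 mxE ltxx.
Qed.

(** The common part [P_u P_v] of both sides drops out, leaving a multiple of
    the stepsize [b]. *)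
Lemma step_equation_moments u (a b t : R) :
    step_mx A a \in unitmx -> step_mx A b \in unitmx ->
  let v := step_mx A a *m u in
  let w := step_mx A b *m v in
  let M2 := invmx (step_mx A a) in
  let M1 := invmx (step_mx A b) in
    dotv u (M2 *m step_mx A t *m w) * dotv v (M1 *m step_mx A t *m w)
    - dotv u (M2 *m M1 *m step_mx A t *m w) * dotv v (step_mx A t *m w)
  = b * ((dotv u u - t * dotv u (A *m u))
           * (dotv v (A *m v) - t * dotv v (A *m (A *m v)))
         - (dotv u (A *m u) - t * dotv u (A *m (A *m u)))
           * (dotv v v - t * dotv v (A *m v))).
Proof.
move=> unit_a unit_b v w M2 M1.
have M1w : M1 *m step_mx A t *m w = step_mx A t *m v.
  exact: invmx_step_cancel.
have M2w : M2 *m step_mx A t *m w = step_mx A t *m (step_mx A b *m u).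
  rewrite /w /v (mulmxA (step_mx A b)) step_mx_comm -(mulmxA (step_mx A a)).
  exact: invmx_step_cancel.
have M21w : M2 *m M1 *m step_mx A t *m w = step_mx A t *m u.
  rewrite -(mulmxA M2) -[M2 *m _ *m _]mulmxA M1w mulmxA.
  exact: invmx_step_cancel.
rewrite M1w M2w M21w /w; move: (v) => v'.
rewrite !step_mxM !(mulmxBr, dotvBr, =^~ scalemxAr, dotvZr).
by ring.
Qed.

(** Dividing by [c1 d1 (p1 - q1)], where [p1], [q1] are the BB1 stepsizes
    and [c1], [d1] the moments [w'Aw]. *)
Lemma moments_quadratic (c0 c1 c2 d0 d1 d2 t : R) :
    c1 != 0 -> c2 != 0 -> d1 != 0 -> d2 != 0 -> c0 / c1 != d0 / d1 ->
  let D := (c1 / c2) * (d1 / d2) * (c0 / c1 - d0 / d1) in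
    (c0 - t * c1) * (d1 - t * d2) - (c1 - t * c2) * (d0 - t * d1)
  = c1 * d1 * (c0 / c1 - d0 / d1)
    * ((c1 / c2 - d1 / d2) / D * t ^+ 2
       - ((c0 / c1) * (c1 / c2) - (d0 / d1) * (d1 / d2)) / D * t + 1).
Proof.
move=> c1_neq0 c2_neq0 d1_neq0 d2_neq0 neq D.
have D_neq0 : c0 / c1 - d0 / d1 != 0 by rewrite subr_eq0.
(* Naming the difference [e] turns the nonzero numerator of
   [c0 / c1 - d0 / d1] into an atom for the field side conditions. *)
rewrite /D; have : c0 = c1 * (c0 / c1 - d0 / d1 + d0 / d1).
  by rewrite subrK mulrC divfK.
move: (c0 / c1 - d0 / d1) D_neq0 => e e_neq0 ->.
by field; rewrite c1_neq0 c2_neq0 d1_neq0 d2_neq0 e_neq0.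
Qed.

Section Iteration.
Variables (b : 'cV[R]_n) (x : nat -> 'cV[R]_n) (alpha : nat -> R).

Lemma grad_step j : x j.+1 = x j - alpha j *: g A b x j ->
  g A b x j.+1 = step_mx A (alpha j) *m g A b x j.
Proof.
move=> xS; rewrite step_mxM {1}/g /grad xS mulmxBr -scalemxAr.
by rewrite addrAC.
Qed.

Lemma step_neq0 j : x j.+1 = x j - alpha j *: g A b x j ->
  s x j != 0 -> alpha j != 0 /\ g A b x j != 0.
Proof.
move=> xS; have -> : s x j = - (alpha j *: g A b x j).
  by rewrite /s xS addrC addKr.
by rewrite oppr_eq0 scaler_eq0 negb_or => /andP.
Qed.

(** Differences of iterates are multiples of the gradient, and the multiple
    cancels in each BB quotient. *)
Lemma BB_moments j : x j.+1 = x j - alpha j *: g A b x j -> s x j != 0 ->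
  let u := g A b x j in
  BB1 A b x j.+1 = dotv u u / dotv u (A *m u) /\
  BB2 A b x j.+1 = dotv u (A *m u) / dotv u (A *m (A *m u)).
Proof.
move=> xS s_neq0 u; have [al_neq0 u_neq0] := step_neq0 j xS s_neq0.
have sE : s x j = - alpha j *: u by rewrite /s xS addrC addKr scaleNr.
have yE : y A b x j = - alpha j *: (A *m u).
  by rewrite /y (grad_step j xS) step_mxM addrC addKr scaleNr.
rewrite /BB1 /BB2 /= sE yE !dotvZl !dotvZr dotv_AA.
have m1_neq0 := lt0r_neq0 (dotv_A_gt0 u u_neq0).
have m2_neq0 := lt0r_neq0 (dotv_AA_gt0 u u_neq0).
by split; field; rewrite al_neq0 ?m1_neq0 ?m2_neq0.
Qed.

Lemma BB2_gt0 j : x j.+1 = x j - alpha j *: g A b x j -> s x j != 0 ->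
  0 < BB2 A b x j.+1.
Proof.
move=> xS s_neq0; have [_ ->] := BB_moments j xS s_neq0.
have [_ u_neq0] := step_neq0 j xS s_neq0.
by rewrite divr_gt0 ?dotv_A_gt0 ?dotv_AA_gt0.
Qed.

Lemma stepsize_eqn_quadratic j (t : R) :
    x j.+1 = x j - alpha j *: g A b x j ->
    x j.+2 = x j.+1 - alpha j.+1 *: g A b x j.+1 ->
    s x j != 0 -> s x j.+1 != 0 ->
    step_mx A (alpha j) \in unitmx -> step_mx A (alpha j.+1) \in unitmx ->
    BB1 A b x j.+1 != BB1 A b x j.+2 ->
  stepsize_eqn A b x alpha j.+2 t <->
  phi13 A b x j.+2 * t ^+ 2 - phi23 A b x j.+2 * t + 1 = 0.
Proof.
move=> xS xSS sj sSj unit_j unit_Sj.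
rewrite /stepsize_eqn /phi13 /phi23 !subSS !subn0.
have [-> ->] := BB_moments j xS sj; have [-> ->] := BB_moments j.+1 xSS sSj.
have [_ u_neq0] := step_neq0 j xS sj.
have [be_neq0 v_neq0] := step_neq0 j.+1 xSS sSj.
have c1 := lt0r_neq0 (dotv_A_gt0 _ u_neq0).
have c2 := lt0r_neq0 (dotv_AA_gt0 _ u_neq0).
have d1 := lt0r_neq0 (dotv_A_gt0 _ v_neq0).
have d2 := lt0r_neq0 (dotv_AA_gt0 _ v_neq0).
move=> neq.
have := step_equation_moments (g A b x j) (alpha j) (alpha j.+1) t unit_j unit_Sj.
rewrite /= -(grad_step j xS) -(grad_step j.+1 xSS).
rewrite (moments_quadratic _ _ _ _ _ _ t c1 c2 d1 d2 neq) => eqnE.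
have unit_factor : alpha j.+1 * (dotv (g A b x j) (A *m g A b x j)
    * dotv (g A b x j.+1) (A *m g A b x j.+1)
    * (dotv (g A b x j) (g A b x j) / dotv (g A b x j) (A *m g A b x j)
       - dotv (g A b x j.+1) (g A b x j.+1)
         / dotv (g A b x j.+1) (A *m g A b x j.+1))) != 0.
  by rewrite !mulf_neq0 // subr_eq0.
rewrite mulrA in eqnE; split=> [eqn | quad].
  by apply: (mulfI unit_factor); rewrite mulr0 -eqnE eqn subrr.
by apply/eqP; rewrite -subr_eq0 eqnE quad mulr0.
Qed.

End Iteration.
End Moments.

(** With equal BB2 stepsizes, [phi23] is the reciprocal of their common
    value. *)
Lemma phi13_eq0_phi23_gt0 (R : realType) (n : nat) (A : 'M[R]_n)
    (b : 'cV[R]_n) (x : nat -> 'cV[R]_n) (k : nat) :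
    0 < BB2 A b x (k - 1) -> 0 < BB2 A b x k ->
    BB1 A b x (k - 1) != BB1 A b x k ->
  phi13 A b x k = 0 -> 0 < phi23 A b x k.
Proof.
rewrite /phi13 /phi23; move: (BB2 _ _ _ (k - 1)) (BB2 _ _ _ k) => p2 q2.
move: (BB1 _ _ _ (k - 1)) (BB1 _ _ _ k) => p1 q1 p2_gt0 q2_gt0 neq /eqP.
have p1q1 : p1 - q1 != 0 by rewrite subr_eq0.
have p2_neq0 := lt0r_neq0 p2_gt0; have q2_neq0 := lt0r_neq0 q2_gt0.
rewrite mulf_eq0 invr_eq0 !mulf_eq0 (negPf p2_neq0) (negPf q2_neq0) (negPf p1q1).
rewrite !orbF subr_eq0 => /eqP ->.
have -> : (p1 * q2 - q1 * q2) / (q2 * q2 * (p1 - q1)) = q2^-1.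
  by field; rewrite q2_neq0.
by rewrite invr_gt0.
Qed.

Theorem theorem2p6 (R : realType) (n : nat) (A : 'M[R]_n) (b : 'cV[R]_n)
    (x : nat -> 'cV[R]_n) (alpha : nat -> R) (k : nat)
    (A_spd : sym_posdef A)
    (k_ge3 : (3 <= k)%N)
    (x_iter : forall j : nat, (1 <= j < k)%N ->
       x j.+1 = x j - alpha j *: g A b x j)
    (s2_neq0 : s x (k - 2) != 0)
    (s1_neq0 : s x (k - 1) != 0)
    (inv2 : step_mx A (alpha (k - 2)%N) \in unitmx)
    (inv1 : step_mx A (alpha (k - 1)%N) \in unitmx)
    (eqn_solvable : exists t : R, stepsize_eqn A b x alpha k t)
    (BB1_neq : BB1 A b x (k - 1) != BB1 A b x k) :
  stepsize_eqn A b x alpha k (alpha_new A b x k).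
Proof.
case: k k_ge3 x_iter s2_neq0 s1_neq0 inv2 inv1 eqn_solvable BB1_neq => [|[|j]] //.
move=> j_gt0 x_iter; rewrite !subSS !subn0 => sj sSj unit_j unit_Sj [t eqn_t] neq.
have xS : x j.+1 = x j - alpha j *: g A b x j.
  by apply: x_iter; rewrite leqnSn andbT.
have xSS : x j.+2 = x j.+1 - alpha j.+1 *: g A b x j.+1.
  by apply: x_iter; rewrite ltnSn.
have quadE r := stepsize_eqn_quadratic R n A A_spd b x alpha j r
  xS xSS sj sSj unit_j unit_Sj neq.
apply/quadE/reciprocal_quadratic_root; first by exists t; apply/quadE.
apply: phi13_eq0_phi23_gt0; rewrite ?subSS ?subn0 //.
- exact: BB2_gt0 A_spd b x alpha j xS sj.
- exact: BB2_gt0 A_spd b x alpha j.+1 xSS sSj.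
Qed.
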